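(* Let $G$ be a connected bipartite graph. Then $G$ attains equality in the inequality $a(G)-\alpha(G)\leq 2+\mu(G)-2\sqrt{1+\mu(G)}$ (which holds for every bipartite graph), that is, $$a(G)-\alpha(G)=2+\mu(G)-2\sqrt{1+\mu(G)},$$ if and only if there are an integer $q\geq 2$ and a partition $V(G)=A\,\dot\cup\,B$ with the following properties: (1) $B=B_1\,\dot\cup\,B_2$, where $|B_1|=|B_2|=q-1$, and $G[B]\cong K_{q-1,q-1}$ with partite classes $B_1$ and $B_2$; (2) $G[A]$ is a matching of $(q-1)^2$ edges together with isolated vertices; (3) $A$ is a maximum annihilating set of $G$; (4) $\alpha(G)=\alpha(G[A])$; (5) the resulting graph is connected. Equivalently, condition (4) may be replaced by the following explicit cross-edge condition: for every set $S\subseteq B_i$, $i\in\{1,2\}$, $$|S|+\alpha\bigl(G[A\setminus N_G(S)]\bigr)\leq \alpha(G[A]).$$ For every graph satisfying these conditions one has $\mu(G)=q^2-1$ and $a(G)-\alpha(G)=(q-1)^2$.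
   Context: All graphs are finite, simple and undirected. For a graph $G$, $m(G)$ is the number of edges, $d(v)$ is the degree of a vertex $v$, $\alpha(G)$ is the independence number, $\mu(G)$ is the matching number, $G[X]$ is the subgraph induced by $X\subseteq V(G)$, and $N_G(S)$ is the set of vertices having a neighbour in $S$. A set $A\subseteq V(G)$ is annihilating if $\sum_{v\in A}d(v)\leq m(G)$; the annihilation number $a(G)$ is the maximum size of an annihilating set (equivalently, with degree sequence $d_1\leq\cdots\leq d_n$, $a(G)=\max\{k:\sum_{i=1}^k d_i\leq m(G)\}$), and a maximum annihilating set is an annihilating set of size $a(G)$. ''A matching of $k$ edges together with isolated vertices'' means a disjoint union of $k$ copies of $K_2$ and some number (possibly zero) of isolated vertices.
   Formalization: The characterizations are stated for connected bipartite graphs with at least two vertices: the single-vertex graph attains equality (both sides are 0) but has no partition with q ≥ 2, since B would need at least two vertices. *)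

(* Defs.v *)
From mathcomp Require Import all_boot all_order all_algebra.

Set Implicit Arguments.
Unset Strict Implicit.
Unset Printing Implicit Defensive.

Record sgraph := SGraph {
  vert :> finType;
  adj : rel vert;
  adj_sym : symmetric adj;
  adj_irr : irreflexive adj }.

Section Invariants.
Variable G : sgraph.
Implicit Types (S A : {set G}) (M : {set {set G}}).

Definition nbhd S : {set G} := [set v | [exists u in S, adj u v]].

Definition deg (v : G) : nat := #|[set u | adj v u]|.

Definition edges : {set {set G}} :=
  [set [set p.1; p.2] | p : G * G & adj p.1 p.2].

Definition nedges : nat := #|edges|.

Definition independent S : bool := [forall x in S, forall y in S, ~~ adj x y].

Definition alpha : nat := \max_(S : {set G} | independent S) #|S|.

Definition matching M : bool := (M \subset edges) && trivIset M.

Definition mu : nat := \max_(M : {set {set G}} | matching M) #|M|.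

Definition annihilating A : bool := \sum_(v in A) deg v <= nedges.

Definition annihilation : nat := \max_(A : {set G} | annihilating A) #|A|.

Definition max_annihilating A : bool :=
  annihilating A && (#|A| == annihilation).

Definition bipartite : Prop :=
  exists X Y : {set G},
    [/\ X :|: Y = [set: G], [disjoint X & Y], independent X & independent Y].

Definition connected : Prop := forall x y : G, connect (@adj G) x y.

(* The one-vertex graph attains equality in the bound (both sides vanish) but
   has no decomposition with q >= 2; it would correspond to q = 1. *)
Definition nontrivial : Prop := 1 < #|G|.

End Invariants.

Section Induced.
Variables (G : sgraph) (X : {set G}).

Definition induced_adj : rel {x : G | x \in X} :=
  fun x y => adj (val x) (val y).

Lemma induced_sym : symmetric induced_adj.
Proof. by move=> x y; apply: adj_sym. Qed.

Lemma induced_irr : irreflexive induced_adj.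
Proof. by move=> x; apply: adj_irr. Qed.

Definition induced : sgraph := SGraph induced_sym induced_irr.

End Induced.

Definition is_iso (G H : sgraph) (f : G -> H) : Prop :=
  bijective f /\ forall x y : G, adj (f x) (f y) = adj x y.

Definition isomorphic (G H : sgraph) : Prop := exists f : G -> H, is_iso f.

Definition is_inl (S T : Type) (u : S + T) : bool :=
  if u is inl _ then true else false.

Section CompleteBipartite.
Variables p r : nat.

Definition Kbip_adj : rel ('I_p + 'I_r) := fun u v => is_inl u != is_inl v.

Lemma Kbip_sym : symmetric Kbip_adj.
Proof. by move=> u v; rewrite /Kbip_adj eq_sym. Qed.

Lemma Kbip_irr : irreflexive Kbip_adj.
Proof. by move=> u; rewrite /Kbip_adj eqxx. Qed.

Definition Kbip : sgraph := SGraph Kbip_sym Kbip_irr.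

End CompleteBipartite.

(* k disjoint copies of K_2, the i-th on (i, false) and (i, true), together
   with s isolated vertices. *)
Section MatchingGraph.
Variables k s : nat.

Definition kK2_adj : rel ('I_k * bool + 'I_s) := fun u v =>
  match u, v with
  | inl (i, b), inl (j, c) => (i == j) && (b != c)
  | _, _ => false
  end.

Lemma kK2_sym : symmetric kK2_adj.
Proof.
by case=> [[i b]|i] [[j c]|j] //=; rewrite eq_sym (eq_sym b).
Qed.

Lemma kK2_irr : irreflexive kK2_adj.
Proof. by case=> [[i b]|i] //=; rewrite !eqxx. Qed.

Definition kK2 : sgraph := SGraph kK2_sym kK2_irr.

End MatchingGraph.

Section Extremal.
Variable G : sgraph.

Definition complete_bipartite_on (n : nat) (B B1 B2 : {set G}) : Prop :=
  exists f : induced B -> Kbip n n,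
    [/\ is_iso f,
        B1 = [set val x | x : induced B & is_inl (f x)]
      & B2 = [set val x | x : induced B & ~~ is_inl (f x)]].

Definition matching_with_isolated (k : nat) (H : sgraph) : Prop :=
  exists s : nat, isomorphic H (kK2 k s).

(* All conditions on the decomposition except the one on the independence
   number, which comes in the two forms below. *)
Record decomposition (q : nat) (A B B1 B2 : {set G}) : Prop := Decomposition {
  dec_cover : A :|: B = [set: G];
  dec_disjoint : [disjoint A & B];
  dec_coverB : B1 :|: B2 = B;
  dec_disjointB : [disjoint B1 & B2];
  dec_card1 : #|B1| = q - 1;
  dec_card2 : #|B2| = q - 1;
  dec_B : complete_bipartite_on (q - 1) B B1 B2;
  dec_A : matching_with_isolated ((q - 1) ^ 2) (induced A);
  dec_annih : max_annihilating A;
  dec_conn : connected G }.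

Definition alpha_condition (A : {set G}) : Prop := alpha G = alpha (induced A).

Definition cross_edge_condition (A B1 B2 : {set G}) : Prop :=
  forall S : {set G}, S \subset B1 \/ S \subset B2 ->
    #|S| + alpha (induced (A :\: nbhd S)) <= alpha (induced A).

End Extremal.

(* Main.v *)
Require Import Defs.
From mathcomp Require Import all_boot all_order all_algebra zify ring lra.
Import Order.TTheory GRing.Theory Num.Theory.

(** Let [A] be a maximum annihilating set, [B] its complement, and write [e(C)]
    for the number of edges inside [C]; double counting degrees shows that [A] is
    annihilating iff [e(A) <= e(B)].  By Koenig and Gallai,
    [alpha(G) + mu(G) = |G|], so [a(G) - alpha(G) = mu(G) - |B|].  Deleting one
    endpoint of each edge inside [A] gives [|A| - alpha(G) <= e(A)], and if the
    bipartition splits [B] into parts of sizes [b1] and [b2] then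
    [e(A) <= e(B) <= b1 b2 <= |B|^2 / 4].  Hence [4 (mu + 1) <= (|B| + 2)^2], which
    is the bound.  Equality makes every step tight: [b1 = b2 = q - 1], [G[B]] is
    complete bipartite, [e(A) = (q - 1)^2], and no two edges inside [A] share a
    vertex, since otherwise fewer than [e(A)] deletions would suffice. *)

Set Implicit Arguments.
Unset Strict Implicit.
Unset Printing Implicit Defensive.

(** * Koenig's theorem by uncrossing vertex covers *)

(* Unless one of the two covers already covers [E], both miss [x], so each
   contains the other's missing endpoint [y1] or [y2].  Then (meet, join) covers
   [E], and (join, meet) does after adding [x]; their sizes sum to at most one
   more than the sizes of the given covers, so one of them is small enough. *)
Lemma cover_uncross (X Y : finType) (E : X -> Y -> Prop) (x : X) (y1 y2 : Y)
    (P1 P2 : {set X}) (Q1 Q2 : {set Y}) :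
    y1 <> y2 -> E x y1 -> E x y2 ->
    (forall u v, E u v -> (u, v) <> (x, y1) -> u \in P1 \/ v \in Q1) ->
    (forall u v, E u v -> (u, v) <> (x, y2) -> u \in P2 \/ v \in Q2) ->
  exists (P : {set X}) (Q : {set Y}),
    (forall u v, E u v -> u \in P \/ v \in Q) /\
    #|P| + #|Q| <= maxn (#|P1| + #|Q1|) (#|P2| + #|Q2|).
Proof.
move=> ny Ey1 Ey2 cov1 cov2.
case: (boolP ((x \in P1) || (y1 \in Q1))) => [/orP c1|].
  exists P1, Q1; split; last exact: leq_maxl.
  by move=> u v Euv; have [[-> ->]//|/eqP] := eqVneq (u, v) (x, y1); apply: cov1.
case: (boolP ((x \in P2) || (y2 \in Q2))) => [/orP c2 _|].
  exists P2, Q2; split; last exact: leq_maxr.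
  by move=> u v Euv; have [[-> ->]//|/eqP] := eqVneq (u, v) (x, y2); apply: cov2.
rewrite !negb_or => /andP[xP2 _] /andP[xP1 _].
have y2Q1 : y2 \in Q1.
  by case: (cov1 _ _ Ey2) => [[/esym]//|xP|//]; rewrite xP in xP1.
have y1Q2 : y1 \in Q2.
  by case: (cov2 _ _ Ey1) => [[]//|xP|//]; rewrite xP in xP2.
have cP := cardsUI P1 P2; have cQ := cardsUI Q1 Q2.
have [le1|gt1] := leqP (#|P1 :&: P2| + #|Q1 :|: Q2|)
                       (maxn (#|P1| + #|Q1|) (#|P2| + #|Q2|)).
  exists (P1 :&: P2), (Q1 :|: Q2); split=> // u v Euv.
  have [[_ ->]|/eqP n1] := eqVneq (u, v) (x, y1).
    by right; rewrite inE y1Q2 orbT.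
  have [[_ ->]|/eqP n2] := eqVneq (u, v) (x, y2); first by right; rewrite inE y2Q1.
  rewrite !inE.
  by case: (cov1 _ _ Euv n1) (cov2 _ _ Euv n2) => -> [] ->; rewrite ?orbT; auto.
exists (x |: (P1 :|: P2)), (Q1 :&: Q2); split; last first.
  have : #|x |: (P1 :|: P2)| <= (#|P1 :|: P2|).+1.
    by rewrite cardsU1 -add1n leq_add2r leq_b1.
  by lia.
move=> u v Euv; have [->|nx] := eqVneq u x; first by left; rewrite setU11.
have n y : (u, v) <> (x, y) by case=> ux _; rewrite ux eqxx in nx.
rewrite !inE.
by case: (cov1 _ _ Euv (n _)) (cov2 _ _ Euv (n _)) => -> [] ->; rewrite ?orbT; auto.
Qed.

(** Induction on the number of edges. If no two edges share an endpoint, [E] is itself the matching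
    and its left endpoints cover it. Otherwise delete in turn each of two edges sharing an endpoint;
    [cover_uncross] merges the two covers obtained by induction into a cover of all of [E]. *)
Lemma koenig (X Y : finType) (E : {set X * Y}) :
  exists (M : {set X * Y}) (P : {set X}) (Q : {set Y}),
    [/\ M \subset E, {in M &, injective fst}, {in M &, injective snd},
        forall u v, (u, v) \in E -> u \in P \/ v \in Q
      & #|P| + #|Q| <= #|M|].
Proof.
have [n] := ubnP #|E|; elim: n E => // n IHn E leEn.
have IH e : e \in E ->
  exists (M : {set X * Y}) (P : {set X}) (Q : {set Y}),
    [/\ M \subset E, {in M &, injective fst} , {in M &, injective snd},
        forall u v, (u, v) \in E -> (u, v) <> e -> u \in P \/ v \in Q
      & #|P| + #|Q| <= #|M|].
  move=> eE; have [|M [P [Q [sM i1 i2 cov le]]]] := IHn (E :\ e).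
    by move: leEn; rewrite (cardsD1 e E) eE.
  exists M, P, Q; split=> //; first exact: subset_trans sM (subsetDl _ _).
  by move=> u v uvE /eqP ne; apply: cov; rewrite !inE ne.
(* The merged cover is no larger than the larger of the two inductive covers, so the matching paired
   with that cover serves. *)
have finish (M1 M2 : {set X * Y}) (P P1 P2 : {set X}) (Q Q1 Q2 : {set Y}) :
    M1 \subset E -> {in M1 &, injective fst} -> {in M1 &, injective snd} ->
    M2 \subset E -> {in M2 &, injective fst} -> {in M2 &, injective snd} ->
    #|P1| + #|Q1| <= #|M1| -> #|P2| + #|Q2| <= #|M2| ->
    (forall u v, (u, v) \in E -> u \in P \/ v \in Q) ->
    #|P| + #|Q| <= maxn (#|P1| + #|Q1|) (#|P2| + #|Q2|) ->
  exists (M : {set X * Y}) (P : {set X}) (Q : {set Y}),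
    [/\ M \subset E, {in M &, injective fst}, {in M &, injective snd},
        forall u v, (u, v) \in E -> u \in P \/ v \in Q
      & #|P| + #|Q| <= #|M|].
  move=> sM1 i1 j1 sM2 i2 j2 le1 le2 cov; rewrite leq_max => /orP[] le.
    by exists M1, P, Q; split=> //; apply: leq_trans le1.
  by exists M2, P, Q; split=> //; apply: leq_trans le2.
case: (boolP [forall p in E, forall r in E, (p.1 == r.1) ==> (p == r)]) => [inj1|].
  case: (boolP [forall p in E, forall r in E, (p.2 == r.2) ==> (p == r)]) => [inj2|].
    exists E, (fst @: E), set0; split=> //.
    - move=> p r pE rE /eqP e; apply/eqP; move: e; apply/implyP.
      by move/forall_inP: inj1 => /(_ p pE) /forall_inP /(_ r rE).
    - move=> p r pE rE /eqP e; apply/eqP; move: e; apply/implyP.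
      by move/forall_inP: inj2 => /(_ p pE) /forall_inP /(_ r rE).
    - by move=> u v uv; left; apply/imsetP; exists (u, v).
    by rewrite cards0 addn0 leq_imset_card.
  rewrite negb_forall_in => /exists_inP[[x1 y] p1E].
  rewrite negb_forall_in => /exists_inP[[x2 y'] p2E] /=.
  rewrite negb_imply => /andP[/eqP yy]; rewrite -{}yy {y'} in p2E *.
  rewrite xpair_eqE eqxx andbT => /eqP nx.
  have [M1 [P1 [Q1 [s1 i1 j1 c1 le1]]]] := IH _ p1E.
  have [M2 [P2 [Q2 [s2 i2 j2 c2 le2]]]] := IH _ p2E.
  (* Here the shared endpoint lies on the right, so uncrossing is applied to the transposed relation
     with the two halves of each cover exchanged. *)
  have [||Q [P [cov le]]] := cover_uncross (E := fun v u => (u, v) \in E)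
      (P1 := Q1) (P2 := Q2) (Q1 := P1) (Q2 := P2) nx p1E p2E.
  - by move=> v u uvE ne; case: (c1 _ _ uvE); [case=> ? ?; apply: ne; congr pair|right|left].
  - by move=> v u uvE ne; case: (c2 _ _ uvE); [case=> ? ?; apply: ne; congr pair|right|left].
  apply: (finish M1 M2 P P1 P2 Q Q1 Q2) => //.
    by move=> u v /cov[]; [right|left].
  by rewrite addnC (addnC #|P1|) (addnC #|P2|).
rewrite negb_forall_in => /exists_inP[[x y1] p1E].
rewrite negb_forall_in => /exists_inP[[x' y2] p2E] /=.
rewrite negb_imply => /andP[/eqP xx]; rewrite -{}xx {x'} in p2E *.
rewrite xpair_eqE eqxx /= => /eqP ny.
have [M1 [P1 [Q1 [s1 i1 j1 c1 le1]]]] := IH _ p1E.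
have [M2 [P2 [Q2 [s2 i2 j2 c2 le2]]]] := IH _ p2E.
have [P [Q [cov le]]] := cover_uncross (E := fun u v => (u, v) \in E) ny p1E p2E c1 c2.
exact: (finish M1 M2 P P1 P2 Q Q1 Q2).
Qed.

(** * Independence numbers under induced subgraphs and isomorphisms *)

Lemma independentP (G : sgraph) (S : {set G}) :
  reflect {in S &, forall x y, ~~ adj x y} (independent S).
Proof.
apply: (iffP forall_inP) => [ind x y xS yS|ind x xS].
  exact: (forall_inP (ind x xS)).
by apply/forall_inP => y yS; apply: ind.
Qed.

Lemma independentS (G : sgraph) (S T : {set G}) :
  S \subset T -> independent T -> independent S.
Proof.
move=> /subsetP ST /independentP ind; apply/independentP=> x y xS yS.
by apply: ind; apply: ST.
Qed.

Lemma leq_alpha (G : sgraph) (S : {set G}) : independent S -> #|S| <= alpha G.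
Proof. by exact: leq_bigmax_cond. Qed.

Lemma alpha_witness (G : sgraph) :
  exists2 S : {set G}, independent S & #|S| = alpha G.
Proof.
have [|S indS eS] := @eq_bigmax_cond _ (@independent G) (fun S => #|S|).
  by apply/card_gt0P; exists set0; apply/independentP=> x y; rewrite inE.
by exists S => //; symmetry; apply: eS.
Qed.

Lemma induced_val_inj (G : sgraph) (A : {set G}) :
  injective (val : induced A -> G).
Proof. exact: val_inj. Qed.

Lemma leq_alpha_induced (G : sgraph) (A S : {set G}) :
  S \subset A -> independent S -> #|S| <= alpha (induced A).
Proof.
move=> /subsetP SA /independentP indS.
have -> : #|S| = #|(val @^-1: S : {set induced A})|.
  rewrite -(card_imset _ (@induced_val_inj G A)); apply: eq_card => x.
  apply/idP/imsetP => [xS|[y yS ->]]; last by rewrite inE in yS.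
  by exists (Sub x (SA _ xS)); rewrite ?inE SubK.
apply: leq_alpha; apply/independentP=> x y; rewrite !inE; exact: indS.
Qed.

Lemma alpha_induced_witness (G : sgraph) (A : {set G}) :
  exists S : {set G},
    [/\ S \subset A, independent S & #|S| = alpha (induced A)].
Proof.
have [S /independentP indS <-] := alpha_witness (induced A).
exists (val @: S); split; last by rewrite card_imset //; apply: induced_val_inj.
  by apply/subsetP=> _ /imsetP[x _ ->]; apply: valP.
by apply/independentP=> _ _ /imsetP[x xS ->] /imsetP[y yS ->]; apply: indS.
Qed.

Lemma alpha_induced_le (G : sgraph) (A : {set G}) :
  alpha (induced A) <= alpha G.
Proof. by have [S [_ indS <-]] := alpha_induced_witness A; apply: leq_alpha. Qed.

Lemma alpha_iso_le (G H : sgraph) (f : G -> H) :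
  is_iso f -> alpha G <= alpha H.
Proof.
move=> [/bij_inj f_inj f_adj]; have [S /independentP indS <-] := alpha_witness G.
rewrite -(card_imset _ f_inj); apply: leq_alpha; apply/independentP.
by move=> _ _ /imsetP[x xS ->] /imsetP[y yS ->]; rewrite f_adj indS.
Qed.

Lemma iso_inverse (G H : sgraph) (f : G -> H) :
  is_iso f -> exists2 g : H -> G, cancel f g /\ cancel g f & is_iso g.
Proof.
move=> [[g fK gK] f_adj]; exists g => //; split; first by exists f.
by move=> x y; rewrite -f_adj !gK.
Qed.

(** An independent set contains at most one end of each copy of [K_2], so forgetting the Boolean is
    injective on it. The ends marked [true], with all isolated vertices, attain the bound. *)
Lemma alpha_kK2 (k s : nat) : alpha (kK2 k s) = k + s.
Proof.
apply/eqP; rewrite eqn_leq; apply/andP; split.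
  have [S /independentP indS <-] := alpha_witness (kK2 k s).
  pose h (u : kK2 k s) : 'I_k + 'I_s :=
    match u with inl (i, _) => inl i | inr j => inr j end.
  have <- : #|{: 'I_k + 'I_s}| = k + s by rewrite card_sum !card_ord.
  rewrite -(@card_in_imset _ _ h); first exact: max_card.
  move=> [[i b]|i] [[j c]|j] xS yS //= [ij]; rewrite ij // in xS *.
  by congr (inl (_, _)); have /= := indS _ _ xS yS; rewrite eqxx /= negbK => /eqP.
pose g (u : 'I_k + 'I_s) : kK2 k s :=
  match u with inl i => inl (i, true) | inr j => inr j end.
have g_inj : injective g by move=> [i|i] [j|j] //= [->].
have -> : k + s = #|g @: setT|.
  by rewrite card_imset // cardsT card_sum !card_ord.
apply: leq_alpha; apply/independentP=> _ _ /imsetP[x _ ->] /imsetP[y _ ->].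
by case: x y => [i|i] [j|j] //=; rewrite andbF.
Qed.

(** Comparing [k + s] with the [2 * k + s] vertices eliminates the unspecified number [s] of
    isolated vertices. *)
Lemma matching_with_isolated_alpha (k : nat) (H : sgraph) :
  matching_with_isolated k H -> alpha H + k = #|H|.
Proof.
move=> [s [f f_iso]]; have [g _ g_iso] := iso_inverse f_iso.
have -> : alpha H = alpha (kK2 k s).
  by apply/eqP; rewrite eqn_leq (alpha_iso_le f_iso) (alpha_iso_le g_iso).
have [bij_f _] := f_iso.
rewrite (bij_eq_card bij_f) card_sum card_prod card_bool !card_ord alpha_kK2.
by lia.
Qed.

Lemma card_induced (G : sgraph) (A : {set G}) : #|induced A| = #|A|.
Proof. exact: card_sig. Qed.

(** * Complete bipartite parts and the cross-edge condition *)

Lemma complete_bipartite_onP (G : sgraph) (n : nat) (B B1 B2 : {set G}) :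
  complete_bipartite_on n B B1 B2 ->
  [/\ independent B1, independent B2 & {in B1 & B2, forall x y, adj x y}].
Proof.
move=> [f [[_ f_adj] -> ->]]; split.
- apply/independentP=> _ _ /imsetP[x + ->] /imsetP[y + ->]; rewrite !inE.
  have <- : adj x y = adj (val x) (val y) by [].
  by rewrite -f_adj /= /Kbip_adj => -> ->.
- apply/independentP=> _ _ /imsetP[x + ->] /imsetP[y + ->]; rewrite !inE.
  have <- : adj x y = adj (val x) (val y) by [].
  by rewrite -f_adj /= /Kbip_adj => /negbTE -> /negbTE ->.
move=> _ _ /imsetP[x + ->] /imsetP[y + ->]; rewrite !inE.
have <- : adj x y = adj (val x) (val y) by [].
by rewrite -f_adj /= /Kbip_adj => -> /negbTE ->.
Qed.

(** For the forward direction, [S] together with an independent subset of [A :\: nbhd S] is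
    independent in [G]. Conversely, completeness of [G[B]] confines a maximum independent set of [G]
    to one class within [B], and its vertices in [A] avoid the neighbours of those in [B]. *)
Lemma alpha_condition_cross_edge (G : sgraph) q (A B B1 B2 : {set G}) :
  decomposition q A B B1 B2 ->
  alpha_condition A <-> cross_edge_condition A B1 B2.
Proof.
case=> covAB disAB covB _ _ _ /complete_bipartite_onP[ind1 ind2 adj12] _ _ _.
split=> [alphaA S Si|cross].
  have indS : independent S by case: Si => /independentS; apply.
  have SB : S \subset B.
    by rewrite -covB; case: Si => Si; rewrite subsetU ?Si ?orbT.
  have [T [TA indT <-]] := alpha_induced_witness (A :\: nbhd S).
  have TnbhdS x : x \in T -> x \in A /\ forall y, y \in S -> ~~ adj y x.
    move=> /(subsetP TA); rewrite !inE => /andP[/negP nxS xA]; split=> // y yS.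
    by apply/negP=> yx; apply: nxS; apply/exists_inP; exists y.
  have ST0 : S :&: T = set0.
    apply/setP=> x; rewrite !inE; apply/negP=> /andP[/(subsetP SB) xB].
    by move=> /TnbhdS[xA _]; rewrite (disjointFr disAB xA) in xB.
  have := cardsUI S T; rewrite ST0 cards0 addn0 => <-.
  rewrite -alphaA; apply: leq_alpha; apply/independentP=> x y.
  rewrite !inE => /orP[] xST /orP[] yST.
  - by move/independentP: indS; apply.
  - by have [_] := TnbhdS _ yST; apply.
  - by rewrite adj_sym; have [_] := TnbhdS _ xST; apply.
  - by move/independentP: indT; apply.
apply/eqP; rewrite eqn_leq alpha_induced_le andbT.
have [I indI <-] := alpha_witness G.
have /independentP indI' := indI.
have IB : I :&: B \subset B1 \/ I :&: B \subset B2.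
  have [|/subsetPn[y]] := boolP (I :&: B \subset B1); first by left.
  rewrite inE -covB inE => /andP[yI] /orP[->//|yB2] _; right.
  apply/subsetP=> x; rewrite !inE => /andP[xI] /orP[xB1|//].
  by have := indI' _ _ xI yI; rewrite adj12.
apply: leq_trans (cross _ IB).
have -> : #|I| = #|I :&: B| + #|I :&: A|.
  rewrite -cardsUI -setIUr setIACA setIid (setIC B) (setUC B) covAB setIT.
  move: disAB; rewrite -setI_eq0 => /eqP ->; by rewrite setI0 cards0 addn0.
rewrite leq_add2l; apply: leq_alpha_induced.
  apply/subsetP=> x; rewrite !inE => /andP[xI ->]; rewrite andbT.
  apply/negP=> /exists_inP[y]; rewrite inE => /andP[yI _].
  by apply/negP; apply: indI'.
exact: independentS (subsetIl _ _) indI.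
Qed.

(** * General graphs: annihilating sets, matchings and complete bipartite models *)

Lemma max_annihilating_witness (G : sgraph) :
  exists A : {set G}, max_annihilating A.
Proof.
have [|A annA aE] := @eq_bigmax_cond _ (@annihilating G) (fun S => #|S|).
  by apply/card_gt0P; exists set0; rewrite unfold_in /annihilating big_set0.
by exists A; rewrite /max_annihilating (annA : annihilating A) eq_sym; apply/eqP.
Qed.

(** Every edge of a matching has an endpoint outside a given independent set, and disjoint edges
    yield distinct endpoints. *)
Lemma alpha_mu_le (G : sgraph) : alpha G + mu G <= #|G|.
Proof.
have [S /independentP indS <-] := alpha_witness G.
have [|M /andP[/subsetP ME triv] muE] :=
  @eq_bigmax_cond _ (@matching G) (fun M => #|M|).
  apply/card_gt0P; exists set0; rewrite unfold_in /matching sub0set.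
  by apply/trivIsetP=> A; rewrite inE.
rewrite (muE : mu G = _) -(cardsC S) leq_add2l.
have pickM e : e \in M -> exists2 x, x \in e & x \notin S.
  move=> /ME /imsetP[[u v]]; rewrite inE /= => uv ->.
  have [uS|uS] := boolP (u \in S); last by exists u; rewrite ?set21.
  have [vS|vS] := boolP (v \in S); last by exists v; rewrite ?set22.
  by have := indS _ _ uS vS; rewrite uv.
(* The chosen endpoint is an option, so the image of the matching is compared with the image of
   [~: S] under [Some]. *)
pose h (e : {set G}) := [pick x | (x \in e) && (x \notin S)].
have hP e : e \in M -> exists x, [/\ h e = Some x, x \in e & x \notin S].
  move=> /pickM[x xe xS]; rewrite /h; case: pickP => [y /andP[ye yS]|/(_ x)].
    by exists y.
  by rewrite xe xS.
rewrite -(@card_in_imset _ _ h) => [|e e' eM e'M hh].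
  rewrite -(card_imset (~: S) (@Some_inj _)); apply: subset_leq_card.
  apply/subsetP=> _ /imsetP[e /hP[x [-> _ xS]] ->].
  by rewrite imset_f // inE.
apply/eqP; apply/negPn/negP=> /(trivIsetP triv _ _ eM e'M) /disjointFr dis.
have [x [hx /dis + _]] := hP _ eM; have [y [hy ye' _]] := hP _ e'M.
by move: hh; rewrite hx hy => -[->]; rewrite ye'.
Qed.

(** The isomorphism is built out of the standard graph, where enumerating the two classes defines it
    directly, and then inverted by [iso_inverse]. *)
Lemma complete_bipartite_on_intro (G : sgraph) (n : nat) (B B1 B2 : {set G}) :
  B1 :|: B2 = B -> [disjoint B1 & B2] -> #|B1| = n -> #|B2| = n ->
  independent B1 -> independent B2 -> {in B1 & B2, forall x y, adj x y} ->
  complete_bipartite_on n B B1 B2.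
Proof.
move=> covB disB c1 c2 /independentP ind1 /independentP ind2 adj12.
pose h (u : Kbip n n) : G :=
  match u with
  | inl i => enum_val (cast_ord (esym c1) i)
  | inr i => enum_val (cast_ord (esym c2) i)
  end.
have hB1 i : h (inl i) \in B1 by apply: enum_valP.
have hB2 i : h (inr i) \in B2 by apply: enum_valP.
have hB u : h u \in B by rewrite -covB inE; case: u => i; rewrite ?hB1 ?hB2 ?orbT.
have h_inj : injective h.
  move=> [i|i] [j|j] hij.
  - by congr inl; move/enum_val_inj/cast_ord_inj: hij.
  - by have := hB1 i; rewrite hij (disjointFl disB).
  - by have := hB1 j; rewrite -hij (disjointFl disB).
  - by congr inr; move/enum_val_inj/cast_ord_inj: hij.
pose g u : induced B := exist _ (h u) (hB u).
have g_iso : is_iso g.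
  split.
    apply: inj_card_bij => [u v [/h_inj]//|].
    rewrite card_induced card_sum !card_ord -covB -[n in n + _]c1 -[n in _ + n]c2.
    by rewrite cardsU leq_subr.
  move=> u v; have -> : adj (g u) (g v) = adj (h u) (h v) by [].
  case: u v => i [] j; rewrite [RHS]/= /Kbip_adj [RHS]/=.
  - by apply/negbTE/ind1.
  - exact: adj12.
  - by rewrite adj_sym adj12.
  - by apply/negbTE/ind2.
have [f [gK fK] f_iso] := iso_inverse g_iso.
exists f; split=> //; apply/setP=> x; apply/idP/imsetP.
- move=> xB1; have xB : x \in B by rewrite -covB inE xB1.
  exists (exist _ x xB) => //; rewrite inE.
  have := fK (exist _ x xB); case: (f _) => //= i /(congr1 val) /= xE.
  by have := hB2 i; rewrite /= xE (disjointFr disB).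
- move=> [y + ->]; rewrite inE -{2}(fK y); case: (f y) => //= i _; exact: hB1.
- move=> xB2; have xB : x \in B by rewrite -covB inE xB2 orbT.
  exists (exist _ x xB) => //; rewrite inE.
  have := fK (exist _ x xB); case: (f _) => //= i /(congr1 val) /= xE.
  by have := hB1 i; rewrite /= xE (disjointFl disB).
- move=> [y + ->]; rewrite inE -{2}(fK y); case: (f y) => //= i _; exact: hB2.
Qed.

(** * Edges of a bipartite graph as arcs, and degree counting *)

Section Bipartition.
Variables (G : sgraph) (X Y : {set G}).
Hypotheses (covXY : X :|: Y = [set: G]) (disXY : [disjoint X & Y]).
Hypotheses (indX : independent X) (indY : independent Y).

(** Orienting every edge inside [C] from [X] to [Y] replaces two-element sets by ordered pairs,
    which are easier to count and are the form [koenig] takes. *)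
Definition arcs (C : {set G}) : {set G * G} :=
  [set p | [&& p.1 \in X :&: C, p.2 \in Y :&: C & adj p.1 p.2]].

Lemma arcsP (C : {set G}) (u v : G) :
  reflect [/\ u \in X, v \in Y, u \in C, v \in C & adj u v]
          ((u, v) \in arcs C).
Proof.
rewrite !inE /=; apply: (iffP idP) => [/and3P[/andP[] ? ? /andP[] ? ? ?]//|].
by case=> -> -> -> -> ->.
Qed.

Lemma notinX (v : G) : (v \notin X) = (v \in Y).
Proof.
have := in_setT v; rewrite -covXY inE => /orP[] vXY.
  by rewrite vXY (disjointFr disXY).
by rewrite vXY (disjointFl disXY).
Qed.

Lemma adj_parts (u v : G) : adj u v -> (u \in X) = (v \in Y).
Proof.
move=> uv; rewrite -notinX; have [uX|uX] := boolP (u \in X).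
  by case: (boolP (v \in X)) => // vX; have := independentP _ indX _ _ uX vX; rewrite uv.
symmetry; apply/negbTE/negP => vX.
rewrite notinX in uX; rewrite notinX in vX.
by have := independentP _ indY _ _ uX vX; rewrite uv.
Qed.

Lemma adj_arc (C : {set G}) (u v : G) : u \in C -> v \in C -> adj u v ->
  (u, v) \in arcs C \/ (v, u) \in arcs C.
Proof.
move=> uC vC uv; have vu : adj v u by rewrite adj_sym.
have [uX|] := boolP (u \in X).
  by left; apply/arcsP; split=> //; rewrite -(adj_parts uv).
by rewrite notinX => uY; right; apply/arcsP; split=> //; rewrite (adj_parts vu).
Qed.

Definition arc_edge (p : G * G) : {set G} := [set p.1; p.2].

Lemma arc_edge_fst p z : p \in arcs setT -> z \in arc_edge p -> z \in X -> z = p.1.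
Proof.
case: p => u v /arcsP[uX vY _ _ _]; rewrite !inE => /orP[/eqP//|/eqP -> vX].
by rewrite (disjointFr disXY vX) in vY.
Qed.

Lemma arc_edge_snd p z : p \in arcs setT -> z \in arc_edge p -> z \in Y -> z = p.2.
Proof.
case: p => u v /arcsP[uX vY _ _ _]; rewrite !inE => /orP[/eqP -> uY|/eqP//].
by rewrite (disjointFr disXY uX) in uY.
Qed.

(** The orientation can be recovered: the endpoint in [X] is the first component and the endpoint in
    [Y] the second. *)
Lemma arc_edge_inj : {in arcs setT &, injective arc_edge}.
Proof.
move=> [u v] [u' v'] p p' e; have /arcsP[uX vY _ _ _] := p.
have /(arc_edge_fst p')/(_ uX) /= -> : u \in arc_edge (u', v') by rewrite -e set21.
by have /(arc_edge_snd p')/(_ vY) /= -> : v \in arc_edge (u', v') by rewrite -e set22.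
Qed.

Lemma edges_arcs : edges G = arc_edge @: arcs setT.
Proof.
apply/setP=> e; apply/imsetP/imsetP=> [[[u v]]|[[u v] /arcsP[_ _ _ _ uv] ->]].
  rewrite inE /= => uv ->; have [a|a] := adj_arc (in_setT u) (in_setT v) uv.
    by exists (u, v).
  by exists (v, u); rewrite // /arc_edge /= setUC.
by exists (u, v); rewrite ?inE.
Qed.

Lemma nedges_arcs : nedges G = #|arcs setT|.
Proof. by rewrite /nedges edges_arcs card_in_imset //; apply: arc_edge_inj. Qed.

(** One summand vanishes, according to the side of [v]. Keeping both lets degree sums be taken over
    sets that meet both sides. *)
Lemma deg_arcs (v : G) :
  deg v = #|[set p in arcs setT | p.1 == v]| + #|[set p in arcs setT | p.2 == v]|.
Proof.
have [vX|] := boolP (v \in X).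
  rewrite [X in _ = _ + X]eq_card0 ?addn0 => [|[u w]]; last first.
    rewrite inE /=; apply/andP=> -[/arcsP[_ wY _ _ _] /eqP wv].
    by rewrite wv (disjointFr disXY) in wY.
  rewrite /deg -[LHS](card_imset _ (f := pair v)) => [|x y [->]//].
  apply: eq_card => -[u w]; rewrite [RHS]inE /=.
  apply/imsetP/andP=> [[x + [-> ->]]|[/arcsP[_ _ _ _ uw] /eqP uv]].
    rewrite inE => vx; rewrite eqxx; split=> //; apply/arcsP.
    by rewrite -(adj_parts vx) !inE.
  by exists w; rewrite ?inE -?uv.
rewrite notinX => vY.
rewrite [X in _ = X + _]eq_card0 ?add0n => [|[u w]]; last first.
  rewrite inE /=; apply/andP=> -[/arcsP[uX _ _ _ _] /eqP uv].
  by rewrite uv (disjointFl disXY) in uX.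
rewrite /deg -[LHS](card_imset _ (f := pair^~ v)) => [|x y [->]//].
apply: eq_card => -[u w]; rewrite [RHS]inE /=.
apply/imsetP/andP=> [[x + [-> ->]]|[/arcsP[_ _ _ _ uw] /eqP wv]].
  rewrite inE adj_sym => xv; rewrite eqxx; split=> //; apply/arcsP.
  by rewrite (adj_parts xv) !inE.
by exists u; rewrite ?inE -?wv // adj_sym.
Qed.

Lemma sum_card_fiber (T : finType) (f : T -> G) (E : {set T}) (A : {set G}) :
  \sum_(v in A) #|[set p in E | f p == v]| = #|[set p in E | f p \in A]|.
Proof.
rewrite -[RHS]sum1_card (partition_big f (mem A)) /=; last first.
  by move=> p; rewrite inE => /andP[].
apply: eq_bigr => v vA; rewrite -sum1_card; apply: eq_bigl => p.
by rewrite !inE -andbA; congr (_ && _); case: eqP => [->|]; rewrite ?vA ?andbF.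
Qed.

(* Arcs inside [A] are counted twice by the degree sum, those inside the
   complement not at all. *)
Lemma sum_deg (A : {set G}) :
  \sum_(v in A) deg v + #|arcs (~: A)| = nedges G + #|arcs A|.
Proof.
rewrite (eq_bigr _ (fun v _ => deg_arcs v)) big_split /= !sum_card_fiber.
rewrite nedges_arcs -cardsUI addnAC; congr (_ + _); last first.
  apply: eq_card => -[u v]; rewrite !inE /=.
  by do !case: (_ \in _); case: (adj u v).
rewrite -cardsUI [X in _ + X](_ : _ = 0) ?addn0; last first.
  apply/eqP; rewrite cards_eq0; apply/eqP/setP=> -[u v]; rewrite !inE /=.
  by do !case: (_ \in _); case: (adj u v).
apply: eq_card => -[u v]; rewrite !inE /=.
by do !case: (_ \in _); case: (adj u v).
Qed.

Lemma annihilating_arcs (A : {set G}) :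
  annihilating A = (#|arcs A| <= #|arcs (~: A)|).
Proof. by rewrite /annihilating; have := sum_deg A; lia. Qed.

(** * Edge counts and independence inside a vertex set *)

(** Removing a vertex cover of [G[A]] leaves an independent set. The cover is kept arbitrary so that
    either the left or the right endpoints of the arcs can be used. *)
Lemma card_alpha_cover (A T : {set G}) :
  (forall u v, (u, v) \in arcs A -> u \in T \/ v \in T) ->
  #|A| <= alpha (induced A) + #|T|.
Proof.
move=> cov; rewrite -(cardsID T A) addnC.
apply: leq_add; last by rewrite subset_leq_card ?subsetIr.
apply: leq_alpha_induced; first exact: subsetDl.
apply/independentP=> u v /setDP[uA /negP uT] /setDP[vA /negP vT].
by apply/negP=> uv; case: (adj_arc uA vA uv) => /cov[].
Qed.

Lemma card_alpha_arcs (A : {set G}) : #|A| <= alpha (induced A) + #|arcs A|.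
Proof.
apply: leq_trans (card_alpha_cover (T := fst @: arcs A) _) _.
  by move=> u v uv; left; apply/imsetP; exists (u, v).
by rewrite leq_add2l leq_imset_card.
Qed.

(** If two arcs shared a left endpoint, the left endpoints would form a cover with fewer than
    [#|arcs A|] vertices, contradicting [card_alpha_cover]; likewise on the right. *)
Lemma arcs_tight_inj (A : {set G}) : alpha (induced A) + #|arcs A| <= #|A| ->
  {in arcs A &, injective fst} /\ {in arcs A &, injective snd}.
Proof.
move=> le; split; apply/imset_injP; rewrite eqn_leq leq_imset_card /=.
  rewrite -(leq_add2l (alpha (induced A))) (leq_trans le) //.
  apply: card_alpha_cover => u v uv; left; apply/imsetP; by exists (u, v).
rewrite -(leq_add2l (alpha (induced A))) (leq_trans le) //.
apply: card_alpha_cover => u v uv; right; apply/imsetP; by exists (u, v).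
Qed.

Lemma arcs_subX (C : {set G}) : arcs C \subset setX (X :&: C) (Y :&: C).
Proof. by apply/subsetP=> p; rewrite !inE => /and3P[-> ->]. Qed.

Lemma card_arcs_le (C : {set G}) : #|arcs C| <= #|X :&: C| * #|Y :&: C|.
Proof. by rewrite -cardsX subset_leq_card ?arcs_subX. Qed.

(** The arcs inside [C] form a subset of the product of its two parts, so equal cardinality makes
    them the whole product. *)
Lemma arcs_complete (C : {set G}) : #|X :&: C| * #|Y :&: C| <= #|arcs C| ->
  {in X :&: C & Y :&: C, forall u v, adj u v}.
Proof.
rewrite -cardsX => le u v uC vC.
have /eqP e : arcs C == setX (X :&: C) (Y :&: C) by rewrite eqEcard arcs_subX.
have : (u, v) \in arcs C by rewrite e inE /= uC.
by case/arcsP.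
Qed.
Lemma card_parts (C : {set G}) : #|X :&: C| + #|Y :&: C| = #|C|.
Proof.
rewrite -cardsUI -setIUl covXY setTI setIACA.
by move: disXY; rewrite -setI_eq0 => /eqP ->; rewrite set0I cards0 addn0.
Qed.

(** Injectivity of both projections makes the arcs pairwise disjoint, since left and right endpoints
    lie on different sides. The vertices of [A] on no arc form the set [Z] of isolated ones. *)
Lemma arcs_matching (A : {set G}) :
  {in arcs A &, injective fst} -> {in arcs A &, injective snd} ->
  matching_with_isolated #|arcs A| (induced A).
Proof.
move=> inj1 inj2.
pose Z := [set x in A | (x \notin fst @: arcs A) && (x \notin snd @: arcs A)].
pose h (u : kK2 #|arcs A| #|Z|) : G :=
  match u with
  | inl (i, b) => if b then (enum_val i).2 else (enum_val i).1
  | inr j => enum_val j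
  end.
have arcV (i : 'I_#|arcs A|) : let: (x, y) := enum_val i in
    [/\ x \in X, y \in Y, x \in A, y \in A & adj x y].
  by move: (enum_valP i); case: (enum_val i) => x y /arcsP.
have hA u : h u \in A.
  case: u => [[i b]|j] /=; last by have := enum_valP j; rewrite inE => /andP[].
  by have := arcV i; case: (enum_val i) => x y [? ? ? ? _]; case: b.
have hX i b : (h (inl (i, b)) \in X) = ~~ b.
  have := arcV i; rewrite /=; case: (enum_val i) => x y [xX yY _ _ _].
  by case: b; rewrite //= (disjointFl disXY).
have hZ j : h (inr j) \in Z by apply: enum_valP.
have hinl i b : h (inl (i, b)) \notin Z.
  rewrite inE /= !negb_and !negbK; apply/orP; right; apply/orP.
  by case: b; [right|left]; rewrite imset_f // enum_valP.
have h_inj : injective h.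
  move=> [[i b]|i] [[j c]|j] hij.
  (* Membership in [X] determines the Boolean; the corresponding projection then determines the
     arc. *)
  - have bc : b = c by apply: negb_inj; rewrite -(hX i) hij hX.
    rewrite -{}bc /= in hij *; congr (inl (_, _)); apply: enum_val_inj.
    by case: b hij; [apply: inj2|apply: inj1]; apply: enum_valP.
  - by have := hinl i b; rewrite hij hZ.
  - by have := hinl j c; rewrite -hij hZ.
  - by congr inr; apply: enum_val_inj.
have h_onto x : x \in A -> exists u, h u = x.
  move=> xA; have [/imsetP[p pA ->]|x1] := boolP (x \in fst @: arcs A).
    by exists (inl (enum_rank_in pA p, false)); rewrite /= enum_rankK_in.
  have [/imsetP[p pA ->]|x2] := boolP (x \in snd @: arcs A).
    by exists (inl (enum_rank_in pA p, true)); rewrite /= enum_rankK_in.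
  have xZ : x \in Z by rewrite inE xA x1.
  by exists (inr (enum_rank_in xZ x)); rewrite /= enum_rankK_in.
have adjZ u j : adj (h u) (h (inr j)) = false.
  apply/negP=> /(adj_arc (hA _) (hA _)) arcu.
  have := hZ j; rewrite inE => /and3P[_ /negP n1 /negP n2].
  by case: arcu => /(imset_f _) arcu; [apply/n2/(arcu _ snd)|apply/n1/(arcu _ fst)].
have adjbb i j b : adj (h (inl (i, b))) (h (inl (j, b))) = false.
  by apply/negP=> /adj_parts; rewrite -notinX !hX; case: (b).
have adjE i j : adj (h (inl (i, false))) (h (inl (j, true))) = (i == j).
  apply/idP/eqP => [ij|<-]; last first.
    by have := arcV i; rewrite /=; case: (enum_val i) => x y [].
  have arcij : (h (inl (i, false)), h (inl (j, true))) \in arcs A.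
    by apply/arcsP; rewrite -(adj_parts ij) hX !hA.
  apply: enum_val_inj; transitivity (h (inl (i, false)), h (inl (j, true))).
    by apply: inj1 => //; apply: enum_valP.
  by apply: inj2 => //; apply: enum_valP.
pose g u : induced A := exist _ (h u) (hA u).
have g_iso : is_iso g.
  split.
    apply: inj_card_bij => [u v [/h_inj]//|].
    rewrite card_induced -(card_imset predT h_inj) subset_leq_card //.
    by apply/subsetP=> x /h_onto[u <-]; rewrite imset_f.
  move=> u v; have -> : adj (g u) (g v) = adj (h u) (h v) by [].
  case: u v => [[i b]|i] [[j c]|j]; rewrite ?adjZ //; last by rewrite adj_sym adjZ.
  by case: b c => [] []; rewrite ?adjbb ?adjE ?[RHS]/= ?andbF ?andbT // adj_sym adjE eq_sym.
have [f _ f_iso] := iso_inverse g_iso.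
by exists #|Z|, f.
Qed.

(** * The integer form of the bound and its equality case *)

(** [koenig] on all arcs gives a matching at least as large as a vertex cover, and the complement of
    the cover is independent. *)
Lemma card_le_alpha_mu : #|G| <= alpha G + mu G.
Proof.
have [M [P [Q [/subsetP ME inj1 inj2 cov le]]]] := koenig (arcs setT).
have leM : #|M| <= mu G.
  rewrite -(@card_in_imset _ _ arc_edge) => [|p r pM rM]; last first.
    by apply: arc_edge_inj; apply: ME.
  apply: leq_bigmax_cond; apply/andP; split.
    by rewrite edges_arcs imsetS //; apply/subsetP.
  apply/trivIsetP=> _ _ /imsetP[p pM ->] /imsetP[r rM ->].
  (* Two matching edges meeting in [z] agree in the coordinate belonging to the side of [z], hence
     coincide. *)
  apply: contraNT => /pred0Pn[z /andP[zp zr]]; apply/eqP; congr arc_edge.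
  have [zX|] := boolP (z \in X).
    by apply: inj1; rewrite // -!(arc_edge_fst (ME _ _) _ zX).
  rewrite notinX => zY.
  by apply: inj2; rewrite // -!(arc_edge_snd (ME _ _) _ zY).
have : #|~: (P :|: Q)| <= alpha G.
  apply: leq_alpha; apply/independentP=> u v.
  rewrite !inE !negb_or => /andP[/negP uP /negP uQ] /andP[/negP vP /negP vQ].
  by apply/negP => /(adj_arc (in_setT u) (in_setT v))[] /cov[].
have := cardsUI P Q; have := cardsC (P :|: Q); lia.
Qed.

(** This is [2 * sqrt (1 + mu) <= b + 2], with [b] the size of the complement, squared to stay in
    the integers. With parts of sizes [x] and [y], it follows from [mu <= x + y + x * y] and
    [4 * (x * y) <= (x + y) ^ 2]. *)
Lemma max_annihilating_mu_le (A : {set G}) : max_annihilating A ->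
  4 * (mu G + 1) <= (#|~: A| + 2) ^ 2.
Proof.
case/andP; rewrite annihilating_arcs => leAB _.
have := alpha_mu_le G; have := alpha_induced_le A; have := card_alpha_arcs A.
have := card_le_alpha_mu; have := cardsC A.
move=> cA le1 le2 le3 le4.
have mu_le : mu G <= #|~: A| + #|arcs A| by lia.
have := card_arcs_le (~: A); rewrite -(card_parts (~: A)) in mu_le *.
have := (nat_AGM2 #|X :&: ~: A| #|Y :&: ~: A|).1.
by rewrite -!mulnn; lia.
Qed.

Lemma max_annihilating_tight (A : {set G}) : max_annihilating A ->
  4 * (mu G + 1) = (#|~: A| + 2) ^ 2 ->
  [/\ #|X :&: ~: A| = #|Y :&: ~: A|,
      #|arcs A| = #|X :&: ~: A| ^ 2, #|arcs (~: A)| = #|X :&: ~: A| ^ 2,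
      alpha G = alpha (induced A) & #|A| = alpha (induced A) + #|arcs A|].
Proof.
case/andP; rewrite annihilating_arcs => leAB _.
have := alpha_mu_le G; have := alpha_induced_le A; have := card_alpha_arcs A.
have := card_le_alpha_mu; have := cardsC A.
have := card_arcs_le (~: A); have := card_parts (~: A).
move: leAB; rewrite -!mulnn.
set x := #|X :&: ~: A|; set y := #|Y :&: ~: A|.
move=> leAB <- leB cA le1 le2 le3 le4 muE.
(* Substituting [mu <= x + y + x * y] into the equality leaves [(x - y) ^ 2 <= 0]. *)
have xy : x = y by nia.
by split=> //; nia.
Qed.

Lemma connected_nedges : connected G -> nontrivial G -> 0 < nedges G.
Proof.
move=> conn /card_gt1P[x [y [_ _ xy]]].
have /connectP[[|z p] /= pth yE] := conn x y; first by rewrite yE eqxx in xy.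
have /andP[xz _] := pth.
by apply/card_gt0P; exists [set x; z]; apply/imsetP; exists (x, z); rewrite ?inE.
Qed.

Lemma tight_decomposition (A : {set G}) :
  connected G -> nontrivial G -> max_annihilating A ->
  4 * (mu G + 1) = (#|~: A| + 2) ^ 2 ->
  exists (q : nat) (A B B1 B2 : {set G}),
    [/\ 2 <= q, decomposition q A B B1 B2 & alpha_condition A].
Proof.
move=> conn nontriv annA /(max_annihilating_tight annA)[xy eA eB alphaE cA].
set n := #|X :&: ~: A| in xy eA eB.
(* [q] is one more than the common size [n] of the two parts of the complement. If [n] were 0, the
   complement would be empty and [G] would have [n ^ 2 = 0] edges, against [connected_nedges]. *)
exists n.+1, A, (~: A), (X :&: ~: A), (Y :&: ~: A); split=> //.
  rewrite ltnS lt0n; apply/eqP=> n0.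
  have := card_parts (~: A); rewrite -xy -/n n0 => /esym /eqP.
  rewrite cards_eq0 => /eqP /(congr1 (@setC _)); rewrite setCK setC0 => AT.
  by have := connected_nedges conn nontriv; rewrite nedges_arcs -AT eA n0.
have BE : X :&: ~: A :|: Y :&: ~: A = ~: A by rewrite -setIUl covXY setTI.
have disB : [disjoint X :&: ~: A & Y :&: ~: A].
  exact: disjointWl (subsetIl _ _) (disjointWr (subsetIl _ _) disXY).
have [inj1 inj2] : {in arcs A &, injective fst} /\ {in arcs A &, injective snd}.
  by apply: arcs_tight_inj; rewrite -cA.
split; rewrite ?subn1 //=.
- exact: setUCr.
- by rewrite -setI_eq0 setICr.
- apply: complete_bipartite_on_intro => //.
  + exact: independentS (subsetIl _ _) indX.
  + exact: independentS (subsetIl _ _) indY.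
  by apply: arcs_complete; rewrite eB -xy mulnn.
by rewrite -eA; apply: arcs_matching.
Qed.

End Bipartition.

(** * Parameters of a decomposition *)

Lemma gallai_koenig (G : sgraph) : bipartite G -> alpha G + mu G = #|G|.
Proof.
move=> [X [Y [covXY disXY indX indY]]]; apply/eqP.
by rewrite eqn_leq alpha_mu_le (card_le_alpha_mu covXY disXY indX indY).
Qed.

(** The structure of [G[A]] gives [alpha G = #|A| - (q - 1) ^ 2], where [#|A|] is the annihilation
    number. Hence [mu G = #|G| - alpha G = 2 * (q - 1) + (q - 1) ^ 2]. *)
Lemma decomposition_parameters (G : sgraph) q (A B B1 B2 : {set G}) :
  bipartite G -> 2 <= q ->
  decomposition q A B B1 B2 -> alpha_condition A ->
  mu G = q ^ 2 - 1 /\ annihilation G = alpha G + (q - 1) ^ 2.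
Proof.
move=> /gallai_koenig gk q2 [cov dis covB disB c1 c2 _ matA annA _] alphaA.
have [_ /eqP aE] := andP annA.
have := matching_with_isolated_alpha matA; rewrite card_induced -alphaA => cA.
have := cardsUI A B; have := cardsUI B1 B2.
move: dis disB; rewrite -!setI_eq0 => /eqP -> /eqP ->.
rewrite cov covB c1 c2 cards0 cardsT.
case: q q2 {c1 c2 matA} cA => // q _; rewrite -!mulnn (_ : q.+1 - 1 = q); last lia.
by move=> *; split; nia.
Qed.

(** * From the integer inequality to square roots *)

Section RealBound.
Local Open Scope ring_scope.
Variables (R : rcfType) (a al m b : nat).
Hypothesis aE : (a + b = al + m)%N.

Let s : R := Num.sqrt (1 + m%:R).

Let sE : s ^+ 2 = 1 + m%:R.
Proof. by rewrite sqr_sqrtr // addr_ge0. Qed.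

Let aR : a%:R - al%:R = m%:R - b%:R :> R.
Proof. by apply/eqP; rewrite subr_eq addrAC eq_sym subr_eq -!natrD addnC -aE. Qed.

(** By [aE] the left side is [m - b], so the claim reads [2 * s <= b + 2]; both sides are
    nonnegative and may be compared through their squares. *)
Lemma sqrt_bound : (4 * (m + 1) <= (b + 2) ^ 2)%N ->
  a%:R - al%:R <= 2 + m%:R - 2 * s.
Proof.
rewrite -(ler_nat R) natrM natrX !natrD => le; rewrite aR.
have s0 : 0 <= s by apply: sqrtr_ge0.
have b0 : 0 <= b%:R :> R by [].
have : 2 * s <= b%:R + 2 by rewrite -ler_sqr ?nnegrE ?exprMn ?sE; lra.
lra.
Qed.

Lemma sqrt_bound_eq :
  a%:R - al%:R = 2 + m%:R - 2 * s <-> (4 * (m + 1) = (b + 2) ^ 2)%N.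
Proof.
rewrite aR; split=> [e|].
  apply/eqP; rewrite -(eqr_nat R) natrM natrX !natrD.
  have -> : b%:R + 2 = 2 * s by lra.
  by rewrite exprMn sE; apply/eqP; ring.
move/(congr1 (fun k => k%:R : R)); rewrite natrM natrX !natrD => e.
have s0 : 0 <= s by apply: sqrtr_ge0.
have b0 : 0 <= b%:R :> R by [].
have sq : (2 * s) ^+ 2 = (b%:R + 2) ^+ 2 by rewrite exprMn sE -e; ring.
have : 2 * s = b%:R + 2 by apply: (pexpIrn (n := 2)); rewrite ?nnegrE //; lra.
lra.
Qed.

End RealBound.

Local Open Scope ring_scope.

Theorem theorem4p3 (R : rcfType) (G : sgraph) (hbip : bipartite G) :
  [/\ (annihilation G)%:R - (alpha G)%:R
        <= 2 + (mu G)%:R - 2 * Num.sqrt (1 + (mu G)%:R) :> R,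
      connected G -> nontrivial G ->
        ((annihilation G)%:R - (alpha G)%:R
           = 2 + (mu G)%:R - 2 * Num.sqrt (1 + (mu G)%:R) :> R
         <-> exists (q : nat) (A B B1 B2 : {set G}),
               [/\ (2 <= q)%N, decomposition q A B B1 B2
                 & alpha_condition A]),
      connected G -> nontrivial G ->
        ((annihilation G)%:R - (alpha G)%:R
           = 2 + (mu G)%:R - 2 * Num.sqrt (1 + (mu G)%:R) :> R
         <-> exists (q : nat) (A B B1 B2 : {set G}),
               [/\ (2 <= q)%N, decomposition q A B B1 B2
                 & cross_edge_condition A B1 B2]),
      forall (q : nat) (A B B1 B2 : {set G}),
        (2 <= q)%N -> decomposition q A B B1 B2 ->
        (alpha_condition A <-> cross_edge_condition A B1 B2)
    & forall (q : nat) (A B B1 B2 : {set G}),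
        (2 <= q)%N -> decomposition q A B B1 B2 -> alpha_condition A ->
        mu G = (q ^ 2 - 1)%N /\
        (annihilation G)%:R - (alpha G)%:R = (q%:R - 1) ^+ 2 :> R].
Proof.
have gk := gallai_koenig hbip.
have [X [Y [covXY disXY indX indY]]] := hbip.
have [A annA] := max_annihilating_witness G.
(* As [#|A|] is the annihilation number, both sides equal the order of [G]; this identity trades
   [a(G) - alpha(G)] for the size of the complement. *)
have aE : (annihilation G + #|~: A| = alpha G + mu G)%N.
  by have /andP[_ /eqP <-] := annA; rewrite gk cardsC.
have alpha_iff : connected G -> nontrivial G ->
    ((annihilation G)%:R - (alpha G)%:R
       = 2 + (mu G)%:R - 2 * Num.sqrt (1 + (mu G)%:R) :> R
     <-> exists (q : nat) (A B B1 B2 : {set G}),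
           [/\ (2 <= q)%N, decomposition q A B B1 B2 & alpha_condition A]).
  move=> conn nontriv; rewrite (sqrt_bound_eq R aE); split.
    exact: (tight_decomposition covXY disXY indX indY).
  move=> [q [A' [B [B1 [B2 [q2 dec alphaA]]]]]].
  have [muE anE] := decomposition_parameters hbip q2 dec alphaA.
  (* The set [A] fixed above may differ from [A'], but the parameters and [aE] force
     [#|~: A| = 2 * (q - 1)], making both sides [4 * q ^ 2]. *)
  by move: aE; rewrite muE anE; case: q q2 {dec muE anE} => // q _; nia.
split=> //.
- exact: sqrt_bound aE (max_annihilating_mu_le covXY disXY indX indY annA).
- move=> conn nontriv; rewrite alpha_iff //.
  by split=> -[q [A' [B [B1 [B2 [q2 dec cond]]]]]]; exists q, A', B, B1, B2;
    split=> //; apply/(alpha_condition_cross_edge dec).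
- by move=> q A' B B1 B2 _ dec; apply: alpha_condition_cross_edge dec.
move=> q A' B B1 B2 q2 dec alphaA.
have [-> ->] := decomposition_parameters hbip q2 dec alphaA.
by split=> //; rewrite natrD addrAC subrr add0r natrX natrB // ltnW.
Qed.
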